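(* Let $r\ge 2$ be an integer and define $\mathrm{low}_{r,2}:[0,1]\to\mathbb{R}$ by: (i) $\mathrm{low}_{r,2}\big(\tfrac{r}{r+s}\big)=gh_r\big(\tfrac{r}{r+s}\big)$ for $s=0,1,2,\dots$; (ii) for $p\in\big(\tfrac{r}{r+1},1\big)$, $\mathrm{low}_{r,2}(p)$ is the maximum of $$\tfrac p2\big(\log r+(r-1)\log(1-\tfrac1r)\big)-\tfrac12\big(p\log p+(1-p)\log(1-p)\big)$$ and $$\tfrac p2\log r-p\log p-(1-p)\log(1-p)+\tfrac r2\log\big(1-\tfrac1{r+1}\big);$$ (iii) for $s=1,2,\dots$ and $p\in\big(\tfrac{r}{r+s+1},\tfrac{r}{r+s}\big)$, $\mathrm{low}_{r,2}(p)$ is the maximum of $$\tfrac p2\log r+\tfrac12\big(-p\log p-2(1-p)\log(1-p)\big)+\tfrac12\Big((r+s-1)\log\big(1-\tfrac1{r+s}\big)-(s-1+p)\log\big(1-\tfrac{1-p}{s}\big)\Big)$$ and $$\tfrac p2\log r+\tfrac12\big(-p\log p-2(1-p)\log(1-p)\big)+\tfrac12\Big((r+s)\log\big(1-\tfrac1{r+s+1}\big)-(s+p)\log\big(1-\tfrac{1-p}{s+1}\big)\Big);$$ (iv) $\mathrm{low}_{r,2}(0)=0$. Then $\mathrm{low}_r(p)\ge\mathrm{low}_{r,2}(p)$ for every $p\in[0,1]$.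
   Context: $gh_r(p):=\tfrac12\big(p\log r-p\log p-2(1-p)\log(1-p)+(r-p)\log(1-\tfrac pr)\big)$, with $0\log0=0$. For a finite graph $G$ (multiple edges allowed), $\phi(l,G)$ is the number of sets of $l$ pairwise vertex-disjoint edges. $\mathcal{G}(2n,r)$ is the set of $r$-regular bipartite graphs on $2n$ vertices, multiple edges allowed, and $\mu(l,2n,r):=\min_{G\in\mathcal{G}(2n,r)}\phi(l,G)$ for $0\le l\le n$. For $p\in[0,1]$, $\mathrm{low}_r(p)$ is the infimum of $\liminf_{k\to\infty}\frac{\log\mu(l_k,2n_k,r)}{2n_k}$ over all sequences of integers $n_k\to\infty$, $0\le l_k\le n_k$, with $l_k/n_k\to p$. *)

(* Defs.v *)
From HB Require Import structures.
From mathcomp Require Import all_boot all_order all_algebra.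
From mathcomp Require Import all_classical all_reals all_analysis.
From mathcomp Require Import ring lra.
Set Implicit Arguments.
Unset Strict Implicit.
Unset Printing Implicit Defensive.
Import Order.TTheory GRing.Theory Num.Theory.
Import numFieldNormedType.Exports.

(* Parallel edges are distinct elements of [edge] with the same ends; there are
   no loops. *)
Record multigraph := Multigraph {
  vertex : finType;
  edge : finType;
  ends : edge -> {set vertex};
  card_ends : forall e, #|ends e| = 2
}.

Definition degree (G : multigraph) (v : vertex G) : nat :=
  #|[set e : edge G | v \in ends e]|.

Definition regular (r : nat) (G : multigraph) : Prop :=
  forall v : vertex G, degree v = r.

Definition bipartite (G : multigraph) : Prop :=
  exists A : {set vertex G}, forall e : edge G, #|ends e :&: A| = 1.

Definition is_matching (G : multigraph) (M : {set edge G}) : bool :=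
  [forall e in M, forall f in M, (e != f) ==> [disjoint ends e & ends f]].

Definition phi (l : nat) (G : multigraph) : nat :=
  #|[set M : {set edge G} | is_matching M && (#|M| == l)]|.

Definition regular_bipartite (m r : nat) (G : multigraph) : Prop :=
  [/\ #|vertex G| = m, regular r G & bipartite G].

(* r copies of the perfect matching between two copies of 'I_n *)
Lemma regular_bipartite_exists (n r : nat) :
  exists G, regular_bipartite n.*2 r G.
Proof.
pose V : finType := (bool * 'I_n)%type; pose E : finType := ('I_n * 'I_r)%type.
pose en (e : E) : {set V} := [set (false, e.1); (true, e.1)].
have cen e : #|en e| = 2 by rewrite cards2.
exists (Multigraph cen); split => /=.
- by rewrite card_prod card_bool card_ord mul2n.
- move=> [b i]; rewrite /degree /=.
  transitivity #|[set (i, j) | j in [set: 'I_r]]|; last first.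
    by rewrite card_imset ?cardsT ?card_ord // => j k [].
  apply: eq_card => -[i' j]; rewrite !inE /= !xpair_eqE.
  apply/idP/imsetP.
    by case: b; rewrite /= ?orbF => /eqP ->; exists j; rewrite ?finset.in_setT.
  by case=> k _ [-> _]; case: b; rewrite /= ?orbF.
- exists [set v : V | v.1] => e.
  rewrite (_ : _ :&: _ = [set (true, e.1)]) ?cards1 //.
  by apply/setP => -[[] i]; rewrite !inE !xpair_eqE /= ?andbT ?andbF.
Qed.

Lemma phi_value_exists (l n r : nat) :
  exists m, `[< exists2 G, regular_bipartite n.*2 r G & phi l G = m >].
Proof.
by have [G rG] := regular_bipartite_exists n r; exists (phi l G);
  apply/asboolP; exists G.
Qed.

(* [mu l n r] is the paper's mu(l, 2n, r). *)
Definition mu (l n r : nat) : nat := ex_minn (phi_value_exists l n r).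

Local Open Scope classical_set_scope.
Local Open Scope ring_scope.

(* [ln 0 = 0] in the library, but [0 < mu l n r] for [l <= n] and [0 < r], as
   a regular bipartite graph of positive degree has a perfect matching. *)
Definition low (R : realType) (r : nat) (p : R) : \bar R :=
  ereal_inf [set x | exists n l : nat -> nat,
    [/\ n @ \oo --> \oo,
        forall k, (l k <= n k)%N,
        (l k)%:R / (n k)%:R @[k --> \oo] --> p &
        x = limn_einf
              (fun k => (ln (mu (l k) (n k) r)%:R / (2 * (n k)%:R))%:E)]].

Definition gh (R : realType) (r : nat) (p : R) : R :=
  2^-1 * (p * ln r%:R - p * ln p - 2 * (1 - p) * ln (1 - p)
          + (r%:R - p) * ln (1 - p / r%:R)).

Definition low2_near1 (R : realType) (r : nat) (p : R) : R :=
  Num.max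
    (p / 2 * (ln r%:R + (r%:R - 1) * ln (1 - r%:R^-1))
      - 2^-1 * (p * ln p + (1 - p) * ln (1 - p)))
    (p / 2 * ln r%:R - p * ln p - (1 - p) * ln (1 - p)
      + r%:R / 2 * ln (1 - (r%:R + 1)^-1)).

Definition low2_between (R : realType) (r s : nat) (p : R) : R :=
  Num.max
    (p / 2 * ln r%:R + 2^-1 * (- (p * ln p) - 2 * (1 - p) * ln (1 - p))
      + 2^-1 * ((r%:R + s%:R - 1) * ln (1 - (r%:R + s%:R)^-1)
                - (s%:R - 1 + p) * ln (1 - (1 - p) / s%:R)))
    (p / 2 * ln r%:R + 2^-1 * (- (p * ln p) - 2 * (1 - p) * ln (1 - p))
      + 2^-1 * ((r%:R + s%:R) * ln (1 - (r%:R + s%:R + 1)^-1)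
                - (s%:R + p) * ln (1 - (1 - p) / (s%:R + 1)))).

(* For p in ]0, 1] put t = r / p - r, so that p = r / (r + t): the case
   p = r / (r + s) is t = s, and p in ]r / (r + s + 1), r / (r + s)[ is
   s < t < s + 1. The lemmas below restate the definition clause by clause. *)
Definition low2 (R : realType) (r : nat) (p : R) : R :=
  if p == 0 then 0 else
  let t := r%:R / p - r%:R in
  let s := Num.truncn t in
  if t == s%:R then gh r p
  else if s == 0%N then low2_near1 r p
  else low2_between r s p.

Lemma low2_gh (R : realType) (r s : nat) : (2 <= r)%N ->
  low2 r (r%:R / (r%:R + s%:R)) = gh r (r%:R / (r%:R + s%:R)) :> R.
Proof.
move=> r2; have r0 : 0 < r%:R :> R by rewrite ltr0n (ltn_trans _ r2).
have s0 : 0 <= s%:R :> R by [].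
have rs0 : r%:R + s%:R != 0 :> R by rewrite gt_eqF // ltr_wpDr.
rewrite /low2 mulf_eq0 invr_eq0 (gt_eqF r0) (negbTE rs0) /=.
have -> : r%:R / (r%:R / (r%:R + s%:R)) - r%:R = s%:R :> R.
  by field; rewrite rs0 (gt_eqF r0).
by rewrite (truncn_def (n := s)) ?eqxx // lexx ltr_nat ltnSn.
Qed.

Lemma low2_itv (R : realType) (r s : nat) (p : R) : (2 <= r)%N ->
  r%:R / (r%:R + s%:R + 1) < p < r%:R / (r%:R + s%:R) ->
  low2 r p = if s == 0%N then low2_near1 r p else low2_between r s p.
Proof.
move=> r2; have r0 : 0 < r%:R :> R by rewrite ltr0n (ltn_trans _ r2).
have s0 : 0 <= s%:R :> R by [].
have rs0 : 0 < r%:R + s%:R :> R by rewrite ltr_wpDr.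
have rs1 : 0 < r%:R + s%:R + 1 :> R by rewrite ltr_wpDr.
case/andP => lp pu.
have p0 : 0 < p by apply: lt_trans lp; rewrite divr_gt0.
have tl : s%:R < r%:R / p - r%:R.
  by rewrite ltrBrDl ltr_pdivlMr // mulrC -ltr_pdivlMr.
have tu : r%:R / p - r%:R < s.+1%:R.
  rewrite ltrBlDl -natr1 addrA ltr_pdivrMr // mulrC.
  by rewrite -ltr_pdivrMr.
rewrite /low2 (gt_eqF p0) (truncn_def (n := s)) ?(ltW tl) //.
by rewrite (gt_eqF tl).
Qed.

Lemma low2_near1E (R : realType) (r : nat) (p : R) : (2 <= r)%N ->
  r%:R / (r%:R + 1) < p < 1 -> low2 r p = low2_near1 r p.
Proof.
move=> r2 hp; have r0 : r%:R != 0 :> R by rewrite pnatr_eq0 -lt0n (ltn_trans _ r2).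
by rewrite (@low2_itv _ _ 0) // addr0 divff.
Qed.

Lemma low2_betweenE (R : realType) (r s : nat) (p : R) :
  (2 <= r)%N -> (1 <= s)%N ->
  r%:R / (r%:R + s%:R + 1) < p < r%:R / (r%:R + s%:R) ->
  low2 r p = low2_between r s p.
Proof. by move=> r2 s1 /(low2_itv r2) ->; rewrite gtn_eqF. Qed.

Lemma low2_0 (R : realType) (r : nat) : low2 r 0 = 0 :> R.
Proof. by rewrite /low2 eqxx. Qed.

(* Main.v *)
Require Import Defs.
From mathcomp Require Import all_boot all_order all_algebra.
From mathcomp Require Import all_classical all_reals all_analysis.
From mathcomp Require Import ring lra.
Set Implicit Arguments.
Unset Strict Implicit.
Unset Printing Implicit Defensive.
Import Order.TTheory GRing.Theory Num.Theory.
Import numFieldNormedType.Exports.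
Local Open Scope ring_scope.

(* In fact [low r p >= gh r p], and [gh r p >= low2 r p] is the log-sum
   inequality. For the first, let [l = q n]. Add [n - l] new vertices to each side
   of the graph and join them to all the old vertices of the other side: every
   matching with [l] edges extends to [(n - l)!^2] perfect matchings. Give weight
   [q / r] to the old edges and [1 / n] to the new ones, so that the weights at
   each vertex add up to 1. The number of perfect matchings is then at least the
   Bethe bound, the product of [(1 - a)^(1 - a) / a^a] over the edge weights [a],
   and Stirling's formula yields [gh].
   The Bethe bound is proved one edge at a time, as for the capacity of real
   stable polynomials; the only correlation inequality needed is
   [Z(S) Z(S - i - j) >= Z(S - i) Z(S - j)] for monomer-dimer partition functions
   and [i], [j] on opposite sides. *)

(** * Capacity inequalities *)

Lemma ln_le_subr1 (R : realType) (x : R) : 0 < x -> ln x <= x - 1.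
Proof.
move=> x0; have := @le_ln1Dx R (x - 1).
by rewrite addrCA subrr addr0; apply; lra.
Qed.

(** Concavity of [ln]: each term is bounded by the tangent of [ln] at the common ratio
    [M = (x + y) / (a + b)], and the two linear errors cancel because [x / M + y / M = a + b]. *)
Lemma log_sum (R : realType) (a b x y : R) :
  0 < a -> 0 < b -> 0 < x -> 0 < y ->
  a * ln (x / a) + b * ln (y / b) <= (a + b) * ln ((x + y) / (a + b)).
Proof.
move=> a0 b0 x0 y0.
have tangent (M c z : R) : 0 < M -> 0 < c -> 0 < z ->
    c * ln (z / c) <= c * ln M + (z / M - c).
  move=> M0 c0 z0; have -> : z / c = M * (z / (c * M)).
    by field; rewrite !gt_eqF.
  have t0 : 0 < z / (c * M) by rewrite divr_gt0 ?mulr_gt0.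
  rewrite lnM ?posrE // mulrDr lerD2l.
  have -> : z / M - c = c * (z / (c * M) - 1) by field; rewrite !gt_eqF.
  by rewrite ler_pM2l // ln_le_subr1.
set M := (x + y) / (a + b).
have M0 : 0 < M by rewrite divr_gt0 ?addr_gt0.
apply: le_trans (lerD (tangent M a x M0 a0 x0) (tangent M b y M0 b0 y0)) _.
have -> : x / M = x * (a + b) / (x + y) by rewrite /M invf_div mulrA.
have -> : y / M = y * (a + b) / (x + y) by rewrite /M invf_div mulrA.
rewrite le_eqVlt; apply/orP; left; apply/eqP.
by field; rewrite gt_eqF ?addr_gt0.
Qed.

(** Exponential form of [log_sum]. The degenerate cases [a = 0] and [x = 0] are covered too, because
    in the Bethe bound a vertex may have no slack left or weight 0. *)
Lemma powR_amgm (R : realType) (a b x y : R) :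
  0 <= a -> 0 < b -> 0 <= x -> 0 < y ->
  (x / a) `^ a * (y / b) `^ b <= ((x + y) / (a + b)) `^ (a + b).
Proof.
move=> a0 b0 x0 y0; case: (eqVneq a 0) => [->|an0].
  rewrite powRr0 mul1r add0r ge0_ler_powR ?nnegrE ?divr_ge0 ?addr_ge0 ?(ltW b0) ?(ltW y0) //.
  by rewrite ler_pM2r ?invr_gt0 // lerDr.
have {a0 an0} a0 : 0 < a by rewrite lt_neqAle eq_sym an0.
case: (eqVneq x 0) => [->|xn0].
  by rewrite mul0r powR0 ?gt_eqF // mul0r powR_ge0.
have {x0 xn0} x0 : 0 < x by rewrite lt_neqAle eq_sym xn0.
rewrite /powR !gt_eqF ?divr_gt0 ?addr_gt0 // -expRD ler_expR.
exact: log_sum.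
Qed.

(** At the critical product [y * z = a / d * (t / s) ^+ 2] the bilinear form of the next lemma is at
    most [a / s ^+ 2]. This evaluates the resulting quotient; in logarithms it is a polynomial
    identity modulo [s + t = 1]. *)
Lemma powR_critical (R : realType) (a d s t : R) :
  0 < a -> 0 < d -> 0 < s -> 0 < t -> s + t = 1 ->
  t `^ t * s `^ s * (a / s ^+ 2 / (a / d * (t / s) ^+ 2) `^ t) =
    (a / s) `^ s * (d / t) `^ t.
Proof.
move=> a0 d0 s0 t0 st.
have ts0 : 0 < t / s by rewrite divr_gt0.
have w0 : 0 < a / d * (t / s) ^+ 2 by rewrite mulr_gt0 ?divr_gt0 ?exprn_gt0.
have as0 : 0 < a / s ^+ 2 by rewrite divr_gt0 ?exprn_gt0.
have tt0 : 0 < t `^ t by rewrite powR_gt0.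
have ss0 : 0 < s `^ s by rewrite powR_gt0.
have wt0 : 0 < (a / d * (t / s) ^+ 2) `^ t by rewrite powR_gt0.
have l0 : 0 < (a / s) `^ s by rewrite powR_gt0 ?divr_gt0.
have r0 : 0 < (d / t) `^ t by rewrite powR_gt0 ?divr_gt0.
have f0 : 0 < a / s ^+ 2 / (a / d * (t / s) ^+ 2) `^ t by rewrite divr_gt0.
apply: ln_inj; rewrite ?posrE ?(mulr_gt0 _ f0) ?(mulr_gt0 l0 r0) ?(mulr_gt0 tt0 ss0) //.
have -> : ln (t `^ t * s `^ s * (a / s ^+ 2 / (a / d * (t / s) ^+ 2) `^ t)) =
    t * ln t + s * ln s + (ln a - ln s *+ 2 -
    t * (ln a - ln d + (ln t - ln s) *+ 2)).
  rewrite (lnM (mulr_gt0 tt0 ss0) f0) (lnM tt0 ss0) (ln_div as0 wt0) !ln_powR.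
  rewrite (ln_div a0 (exprn_gt0 2 s0)) (lnM (divr_gt0 a0 d0) (exprn_gt0 2 ts0)).
  by rewrite (ln_div a0 d0) !lnXn // (ln_div t0 s0).
rewrite (lnM l0 r0) !ln_powR (ln_div a0 s0) (ln_div d0 t0).
move: (ln t) (ln s) (ln a) (ln d) => lt ls la ld.
have -> : t = 1 - s by lra.
ring.
Qed.

(* Raising [b * c] to [a * d] makes the polynomial a product of two linear
   forms at the optimal [y], [z]; there the bound is weighted AM-GM. *)
Lemma bilinear_capacity_pos (R : realType) (a b c d t C : R) :
  0 < a -> 0 <= b -> 0 <= c -> 0 < d -> b * c <= a * d -> 0 < t < 1 ->
  (forall y z, 0 < y -> 0 < z ->
    C * (y `^ t * z `^ t) <= a + b * y + c * z + d * (y * z)) ->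
  t `^ t * (1 - t) `^ (1 - t) * C <= a + d.
Proof.
move=> a0 b0 c0 d0 bcad /andP[t0 t1] HC.
have s0 : 0 < 1 - t by lra.
(* The choice of [z] below divides by [c], which may be 0; it is replaced by a positive [c'] that
   still satisfies the determinant condition. *)
have [c' [c'0 cc' bc']] : exists c', [/\ 0 < c', c <= c' & b * c' <= a * d].
  case: (eqVneq c 0) => [c_eq|cn0].
    exists (a * d / (b + 1)); rewrite c_eq; split.
    - by rewrite divr_gt0 ?mulr_gt0 // ltr_wpDl.
    - by rewrite divr_ge0 ?mulr_ge0 ?addr_ge0 // ltW.
    - rewrite mulrA ler_pdivrMr ?ltr_wpDl // mulrC ler_pM2l ?mulr_gt0 //; lra.
  by exists c; split => //; rewrite lt_neqAle eq_sym cn0.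
(* With these values [b * y] and [c * z] are at most [u], while [d * (y * z) = u ^+ 2 / a]; the form
   is then at most [a * (1 + u / a) ^+ 2 = a / (1 - t) ^+ 2]. *)
pose u := a * t / (1 - t).
have u0 : 0 < u by rewrite /u divr_gt0 // mulr_gt0.
pose z := u / c'; pose y := u * c' / (a * d).
have z0 : 0 < z by rewrite divr_gt0.
have y0 : 0 < y by rewrite /y divr_gt0 // mulr_gt0.
have yz : y * z = (a / d) * (t / (1 - t)) ^+ 2.
  by rewrite /y /z /u; field; rewrite !gt_eqF.
have by_u : b * y <= u.
  rewrite (_ : b * y = u * (b * c' / (a * d))); last by rewrite /y; ring.
  by rewrite ger_pMr // ler_pdivrMr ?mulr_gt0 // mul1r.
have cz_u : c * z <= u.
  by rewrite /z mulrCA ger_pMr // ler_pdivrMr // mul1r.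
have := HC y z y0 z0; rewrite -powRM ?(ltW y0) ?(ltW z0) //.
have P0 : 0 < (y * z) `^ t by rewrite powR_gt0 // mulr_gt0.
have up : a + b * y + c * z + d * (y * z) <= a / (1 - t) ^+ 2.
  rewrite (_ : a / _ = a + u + u + d * (y * z)); first by rewrite !lerD.
  by rewrite yz /u; field; rewrite !gt_eqF.
move=> /le_trans/(_ up); rewrite -ler_pdivlMr // => HC'.
apply: (@le_trans _ _ ((a / (1 - t)) `^ (1 - t) * (d / t) `^ t)); last first.
  have := @powR_amgm R (1 - t) t a d (ltW s0) t0 (ltW a0) d0.
  by rewrite subrK divr1 powRr1 // addr_ge0 ?ltW.
apply: (@le_trans _ _ (t `^ t * (1 - t) `^ (1 - t) * (a / (1 - t) ^+ 2 / (y * z) `^ t))).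
  by rewrite ler_wpM2l // mulr_ge0 ?powR_ge0.
rewrite le_eqVlt; apply/orP; left; apply/eqP.
by rewrite yz powR_critical ?subrK //; lra.
Qed.

(** Follows from the positive case by adding [e / 2] to both [a] and [d], which preserves all
    hypotheses. *)
Lemma bilinear_capacity (R : realType) (a b c d t C : R) :
  0 <= a -> 0 <= b -> 0 <= c -> 0 <= d -> b * c <= a * d -> 0 < t < 1 ->
  (forall y z, 0 < y -> 0 < z ->
    C * (y `^ t * z `^ t) <= a + b * y + c * z + d * (y * z)) ->
  t `^ t * (1 - t) `^ (1 - t) * C <= a + d.
Proof.
move=> a0 b0 c0 d0 bcad t01 HC; apply/ler_addgt0Pr => e e0.
have e2 : 0 < e / 2 by lra.
rewrite (_ : a + d + e = (a + e / 2) + (d + e / 2)); last by field.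
apply: (@bilinear_capacity_pos R _ b c) => //; rewrite ?ltr_wpDl //.
  by apply: le_trans bcad _; rewrite ler_pM // lerDl ltW.
move=> y z y0 z0; apply: le_trans (HC y z y0 z0) _.
by rewrite !lerD ?lerDl ?(ltW e2) // ler_wpM2r ?mulr_ge0 ?lerDl ?(ltW e2) ?(ltW y0) ?(ltW z0).
Qed.

(** * Comparison of [low2] with [gh] *)

Lemma low2_le_gh (R : realType) (r : nat) (p : R) :
  (2 <= r)%N -> 0 < p <= 1 -> low2 r p <= gh r p.
Proof.
move=> r2 /andP[p0 p1].
have r2R : 2 <= r%:R :> R by rewrite (ler_nat _ 2).
have r0 : 0 < r%:R :> R by lra.
have u0 : 0 < 1 - p / r%:R by rewrite subr_gt0 ltr_pdivrMr //; lra.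
(* This is [log_sum] for the values [r], [s] with masses [r - p], [s - 1 + p], all ratios inverted.
   The parameters [s] and [s + 1] give the two expressions of [low2_between], and the parameter 1
   gives the second one of [low2_near1]. *)
have jensen (s : R) : 1 <= s ->
    (r%:R + s - 1) * ln (1 - (r%:R + s)^-1) - (s - 1 + p) * ln (1 - (1 - p) / s)
      <= (r%:R - p) * ln (1 - p / r%:R).
  move=> s1; have s0 : 0 < s by lra.
  have B0 : 0 < s - 1 + p by lra.
  have A0 : 0 < r%:R - p by lra.
  have rs0 : 0 < r%:R + s by lra.
  have := log_sum A0 B0 r0 s0.
  have -> : r%:R - p + (s - 1 + p) = r%:R + s - 1 by ring.
  have C0 : 0 < r%:R + s - 1 by lra.
  have -> : 1 - p / r%:R = (r%:R / (r%:R - p))^-1.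
    by rewrite invf_div mulrBl divff // gt_eqF.
  have -> : 1 - (1 - p) / s = (s / (s - 1 + p))^-1.
    by rewrite invf_div; field; rewrite gt_eqF.
  have -> : 1 - (r%:R + s)^-1 = ((r%:R + s) / (r%:R + s - 1))^-1.
    by rewrite invf_div; field; rewrite gt_eqF.
  rewrite !lnV ?posrE ?divr_gt0 //; lra.
rewrite /low2 gt_eqF //; set t := r%:R / p - r%:R; set s := Num.truncn t.
case: ifPn => // ts; case: ifPn => [/eqP s0|sn0].
  have {ts} pl1 : p < 1.
    rewrite lt_neqAle p1 andbT; move: ts; rewrite s0 /t; apply: contra.
    by move=> /eqP ->; rewrite divr1 subrr.
  rewrite /low2_near1 /gh ge_max; apply/andP; split.
    (* For the first expression, [r - p] is split as [(1 - p) + (r - 1)]: the first share uses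
       [1 - p <= 1 - p / r], the second uses concavity, as [1 - p / r] is the mean of 1 and
       [1 - 1 / r] with weights [1 - p] and [p]. *)
    have w0 : 0 < 1 - r%:R^-1 :> R by rewrite subr_gt0 invf_lt1 //; lra.
    have q0 : 0 < 1 - p by lra.
    have l1 : ln (1 - p) <= ln (1 - p / r%:R).
      rewrite ler_ln ?posrE // lerB // ler_pdivrMr //; nra.
    have l2 : p * ln (1 - r%:R^-1) <= ln (1 - p / r%:R).
      have := log_sum q0 p0 q0 (mulr_gt0 p0 w0).
      rewrite (_ : p * _ / p = 1 - r%:R^-1); last by field; rewrite !gt_eqF.
      rewrite (_ : 1 - p + p * _ = 1 - p / r%:R); last by field; rewrite gt_eqF.
      by rewrite divff ?gt_eqF // ln1 mulr0 add0r subrK mul1r divr1.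
    have h1 : (1 - p) * ln (1 - p) <= (1 - p) * ln (1 - p / r%:R).
      by rewrite ler_pM2l.
    have h2 : (r%:R - 1) * (p * ln (1 - r%:R^-1)) <= (r%:R - 1) * ln (1 - p / r%:R).
      by rewrite ler_wpM2l //; lra.
    lra.
  have := jensen 1 (lexx _); rewrite divr1 addrK subrr add0r subKr; lra.
have s1 : 1 <= s%:R :> R by rewrite (ler_nat _ 1) lt0n.
have h1 := jensen s%:R s1.
have := jensen (s%:R + 1); rewrite addrA !addrK lerDr ler0n => /(_ isT) h2.
by rewrite /low2_between /gh ge_max; apply/andP; split; lra.
Qed.

(** * The Bethe bound for monomer-dimer partition functions *)

Lemma setD1C (V : finType) (S : {set V}) (x y : V) :
  S :\ x :\ y = S :\ y :\ x.
Proof. by apply/setP => k; rewrite !inE andbCA. Qed.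

(* The difference of the two sides obeys a recursion that alternates between
   equal and opposite colours: expanding at [i] leaves the same difference for
   [k], [j] with [k] a neighbour of [i], with a minus sign. *)
Lemma matching_correlation (R : realDomainType) (V : finType) (c : V -> bool)
    (Z : {set V} -> R) (lam : V -> R) (w : V -> V -> R) :
  (forall S, 0 <= Z S) -> (forall i k, 0 <= w i k) ->
  (forall i k, c i = c k -> w i k = 0) ->
  (forall (S : {set V}) i, i \in S -> Z S = lam i * Z (S :\ i) +
    \sum_(k in S :\ i) w i k * Z (S :\ i :\ k)) ->
  forall (S : {set V}) i j, i \in S -> j \in S -> i != j ->
  if c i == c j then Z S * Z (S :\ i :\ j) <= Z (S :\ i) * Z (S :\ j)
  else Z (S :\ i) * Z (S :\ j) <= Z S * Z (S :\ i :\ j).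
Proof.
move=> Z0 w0 wc ZE S; have [n] := ubnP #|S|; elim: n S => // n IH S Sn i j iS jS ij.
have jT : j \in S :\ i by rewrite !inE eq_sym ij.
have iSj : i \in S :\ j by rewrite !inE ij.
have Tn : (#|S :\ i| < n)%N by move: Sn; rewrite (cardsD1 i) iS add1n ltnS.
(* Both [Z S] and [Z (S :\ j)] are expanded at [i]. The [lam i] terms cancel, and the neighbour [j],
   present only in [S], leaves the square. *)
have E : Z S * Z (S :\ i :\ j) - Z (S :\ i) * Z (S :\ j) =
    w i j * Z (S :\ i :\ j) ^+ 2 + \sum_(k in S :\ i :\ j) w i k *
      (Z (S :\ i :\ k) * Z (S :\ i :\ j) - Z (S :\ i) * Z (S :\ i :\ j :\ k)).
  rewrite (ZE S i iS) (ZE (S :\ j) i iSj) (big_setD1 j jT) (setD1C S j i) /=.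
  set A := \sum_(k in _) w i k * Z (S :\ i :\ k).
  set B := \sum_(k in _) w i k * Z (S :\ i :\ j :\ k).
  rewrite (eq_bigr (fun k => w i k * Z (S :\ i :\ k) * Z (S :\ i :\ j) -
     Z (S :\ i) * (w i k * Z (S :\ i :\ j :\ k)))); last by move=> k _; ring.
  by rewrite sumrB -mulr_suml -mulr_sumr -/A -/B; ring.
have IHk k (kT : k \in S :\ i :\ j) := IH (S :\ i) Tn k j.
case: ifPn => [/eqP cij|cij]; [rewrite -subr_le0 | rewrite -subr_ge0]; rewrite E.
  rewrite (wc i j cij) mul0r add0r sumr_le0 // => k.
  rewrite !inE => /and3P[kj ki kS].
  have [cik|cik] := eqVneq (c i) (c k); first by rewrite wc // mul0r.
  apply: mulr_ge0_le0 => //; rewrite subr_le0 (setD1C (S :\ i) j k).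
  have := IHk k; rewrite !inE kj ki kS jS (eq_sym j) ij => /(_ isT isT isT isT).
  by rewrite -cij eq_sym (negbTE cik).
rewrite addr_ge0 ?mulr_ge0 ?sqr_ge0 // sumr_ge0 // => k.
rewrite !inE => /and3P[kj ki kS].
have [cik|cik] := eqVneq (c i) (c k); first by rewrite wc // mul0r.
rewrite mulr_ge0 // subr_ge0 (setD1C (S :\ i) j k).
have := IHk k; rewrite !inE kj ki kS jS (eq_sym j) ij => /(_ isT isT isT isT).
by have -> : c k == c j by move: cij cik; case: (c i) (c j) (c k) => [] [] [].
Qed.

(* Deletion-contraction form of the weighted count of the matchings [M] inside
   [S] with edges in [L], where [M] has weight the product of [lam] over the
   uncovered vertices of [S]. *)
Fixpoint monomer_dimer (R : comPzRingType) (V : finType) (E : Type) (u v : E -> V)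
    (lam : V -> R) (L : seq E) (S : {set V}) : R :=
  if L is e :: L' then
    monomer_dimer u v lam L' S +
    (if (u e \in S) && (v e \in S)
     then monomer_dimer u v lam L' (S :\ u e :\ v e) else 0)
  else \prod_(x in S) lam x.

Lemma monomer_dimer_ge0 (R : realDomainType) (V : finType) (E : Type)
    (u v : E -> V) (lam : V -> R) (L : seq E) (S : {set V}) :
  (forall x, 0 <= lam x) -> 0 <= monomer_dimer u v lam L S.
Proof.
move=> l0; elim: L S => [|e L IH] S /=; first exact: prodr_ge0.
by rewrite addr_ge0 //; case: ifP.
Qed.

Lemma eq_monomer_dimer (R : comPzRingType) (V : finType) (E : Type)
    (u v : E -> V) (lam lam' : V -> R) (L : seq E) (S : {set V}) :
  {in S, lam =1 lam'} -> monomer_dimer u v lam L S = monomer_dimer u v lam' L S.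
Proof.
elim: L S => [|e L IH] S ll /=; first exact: eq_bigr.
rewrite IH //; case: ifP => // _; congr (_ + _); apply: IH => x.
by rewrite !inE => /and3P[_ _]; apply: ll.
Qed.

Definition multiplicity (V : finType) (E : Type) (u v : E -> V) (L : seq E)
    (i k : V) : nat :=
  count (fun e => (u e == i) && (v e == k) || (u e == k) && (v e == i)) L.

Lemma sum_delta (R : pzRingType) (V : finType) (S : {set V}) (x : V) (F : V -> R) :
  \sum_(k in S) (x == k)%:R * F k = if x \in S then F x else 0.
Proof.
case: ifPn => xS; last first.
  by rewrite big1 // => k kS; case: eqP xS => [->|_ _]; rewrite ?kS ?mul0r.
rewrite (bigD1 x) //= eqxx mul1r big1 ?addr0 // => k /andP[_ kx].
by rewrite eq_sym (negbTE kx) mul0r.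
Qed.

(** Either [i] is uncovered or it is matched to some [k]. This turns the recursion on edges into the
    recursion on vertices that [matching_correlation] requires. *)
Lemma monomer_dimer_vertex (R : comPzRingType) (V : finType) (E : Type)
    (u v : E -> V) (lam : V -> R) (L : seq E) (S : {set V}) (i : V) :
  (forall e, u e != v e) -> i \in S ->
  monomer_dimer u v lam L S = lam i * monomer_dimer u v lam L (S :\ i) +
    \sum_(k in S :\ i) (multiplicity u v L i k)%:R *
       monomer_dimer u v lam L (S :\ i :\ k).
Proof.
move=> uv; elim: L S => [|e L IH] S iS /=.
  by rewrite (big_setD1 i) //= [X in _ + X]big1 ?addr0 // => k _; rewrite mul0r.
have [ui|ui] := eqVneq (u e) i.
  rewrite ui iS /= [X in lam i * (_ + X)]ifF; last by rewrite !inE eqxx.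
  have vi : v e != i by rewrite -ui eq_sym.
  rewrite addr0 IH // -addrA; congr (_ + _).
  rewrite [RHS](eq_bigr (fun k => (v e == k)%:R * monomer_dimer u v lam L (S :\ i :\ k)
     + (multiplicity u v L i k)%:R * monomer_dimer u v lam L (S :\ i :\ k))).
    by rewrite big_split /= sum_delta !inE vi /= addrC.
  move=> k; rewrite !inE (negbTE vi) andbF orbF => _.
  by rewrite eqxx /= andbF /= addr0 natrD mulrDl.
have [vi|vi] := eqVneq (v e) i.
  rewrite vi iS andbT [X in lam i * (_ + X)]ifF; last by rewrite !inE eqxx andbF.
  rewrite addr0 IH // -addrA; congr (_ + _).
  rewrite [RHS](eq_bigr (fun k => (u e == k)%:R * monomer_dimer u v lam L (S :\ i :\ k)
     + (multiplicity u v L i k)%:R * monomer_dimer u v lam L (S :\ i :\ k))).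
    by rewrite big_split /= sum_delta !inE ui /= addrC (setD1C S i).
  move=> k; rewrite !inE andbT /= eqxx !andbF => _.
  by rewrite addr0 natrD mulrDl.
rewrite IH // !inE ui vi /=.
case: (boolP ((u e \in S) && (v e \in S))) => [/andP[uS vS]|eS]; last first.
  rewrite !addr0; congr (_ + _); apply: eq_bigr => k _.
  rewrite andbF [if _ then _ else _]ifF ?addr0 //.
  by apply: contraNF eS; rewrite !inE => /andP[/and3P[_ _ ->] /and3P[_ _ ->]].
(* The head edge avoids [i], so contracting it commutes with the expansion at [i]; terms where [k]
   is an end of [e] vanish, since [e] then no longer lies inside the set. *)
rewrite (IH (S :\ u e :\ v e)); last by rewrite !inE !(eq_sym i) vi ui.
rewrite mulrDr addrACA (setD1C (S :\ u e)) (setD1C S (u e)); congr (_ + _).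
rewrite [X in _ + X](_ : _ = \sum_(k in S :\ i) (multiplicity u v L i k)%:R *
  (if (u e \in S :\ i :\ k) && (v e \in S :\ i :\ k)
   then monomer_dimer u v lam L (S :\ i :\ k :\ u e :\ v e) else 0)).
  by rewrite -big_split /=; apply: eq_bigr => k _; rewrite andbF mulrDr.
rewrite big_mkcond [RHS]big_mkcond; apply: eq_bigr => k _.
rewrite !inE ui vi uS vS /= !andbT (eq_sym (u e)) (eq_sym (v e)).
have [->|ku] := eqVneq k (u e); first by rewrite !andbF /= mulr0 if_same.
have [->|kv] := eqVneq k (v e); first by rewrite /= mulr0 if_same.
by rewrite /= (setD1C _ _ k) (setD1C (S :\ i) _ k).
Qed.

(** The partition function is affine in each vertex weight, with slope the partition function of the
    set without that vertex. *)
Lemma monomer_dimer_add (R : comPzRingType) (V : finType) (E : Type)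
    (u v : E -> V) (lam : V -> R) (L : seq E) (S : {set V}) (i : V) (y : R) :
  (forall e, u e != v e) -> i \in S ->
  monomer_dimer u v (fun x => lam x + (if x == i then y else 0)) L S =
    monomer_dimer u v lam L S + y * monomer_dimer u v lam L (S :\ i).
Proof.
move=> uv iS; rewrite !(monomer_dimer_vertex lam L uv iS).
rewrite (monomer_dimer_vertex _ L uv iS) eqxx.
have E1 (T : {set V}) : i \notin T ->
    monomer_dimer u v (fun x => lam x + (if x == i then y else 0)) L T =
    monomer_dimer u v lam L T.
  move=> iT; apply: eq_monomer_dimer => x xT.
  by case: eqP iT => [<-|_ _]; rewrite ?xT ?addr0.
rewrite E1 ?inE ?eqxx // (eq_bigr (fun k => (multiplicity u v L i k)%:R *
       monomer_dimer u v lam L (S :\ i :\ k))); first by rewrite mulrDl addrAC.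
by move=> k _; rewrite E1 // !inE eqxx andbF.
Qed.

(* One edge at a time: uncovering an edge splits it into two half-edges [y], [z]
   that are absorbed in the vertex weights, and [bilinear_capacity] recombines
   them. *)
Lemma monomer_dimer_bethe (R : realType) (V : finType) (c : V -> bool)
    (E : Type) (u v : E -> V) (al : E -> R) (L : seq E) (lam : V -> R) :
  (forall e, c (u e) != c (v e)) -> (forall e, 0 < al e < 1) ->
  (forall x, 0 <= lam x) ->
  (forall x, \sum_(e <- L | (u e == x) || (v e == x)) al e <= 1) ->
  \prod_(e <- L) ((1 - al e) `^ (1 - al e) / al e `^ al e) *
  \prod_x (lam x / (1 - \sum_(e <- L | (u e == x) || (v e == x)) al e))
            `^ (1 - \sum_(e <- L | (u e == x) || (v e == x)) al e)
  <= monomer_dimer u v lam L [set: V].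
Proof.
move=> cuv al01; have uv e : u e != v e by apply: contraNneq (cuv e) => ->.
elim: L lam => [|e L IH] lam lam0 al1.
  rewrite /= big_nil mul1r [leRHS](eq_bigl xpredT) => [|x]; last by rewrite inE.
  by apply: ler_prod => x _; rewrite big_nil subr0 divr1 powRr1 ?lexx ?andbT.
pose be x : R := 1 - \sum_(f <- L | (u f == x) || (v f == x)) al f.
pose be' x : R := be x - (if (u e == x) || (v e == x) then al e else 0).
have beE x : 1 - \sum_(f <- e :: L | (u f == x) || (v f == x)) al f = be' x.
  by rewrite /be' /be big_cons; case: ifP => _; ring.
have be'0 x : 0 <= be' x by rewrite -beE subr_ge0.
rewrite [X in _ * X](eq_bigr (fun x => (lam x / be' x) `^ be' x)); last by move=> x _; rewrite beE.
rewrite big_cons.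
have /andP[t0 t1] := al01 e; set t := al e in be' beE be'0 t0 t1 *.
have tt0 : 0 < t `^ t by rewrite powR_gt0.
set K := \prod_(f <- L) _; set F := \prod_x _.
have K0 : 0 <= K by apply: prodr_ge0 => f _; rewrite divr_ge0 ?powR_ge0.
(* The capacity bound has [t] to the power [t] in the numerator, the Bethe factor has it in the
   denominator; the constant [C] absorbs the square. *)
rewrite (_ : _ * F = t `^ t * (1 - t) `^ (1 - t) * (K * F / (t `^ t * t `^ t)));
  last by field; rewrite gt_eqF.
rewrite /= !inE /=.
apply: (@bilinear_capacity R _ (monomer_dimer u v lam L ([set: V] :\ u e))
   (monomer_dimer u v lam L ([set: V] :\ v e))); rewrite ?monomer_dimer_ge0 ?t0 //.
  have Z0 S := @monomer_dimer_ge0 _ _ _ u v lam L S lam0.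
  pose w i k : R := (multiplicity u v L i k)%:R.
  have wc i k : c i = c k -> w i k = 0.
    move=> cik; rewrite /w /multiplicity (eq_count (a2 := pred0)) ?count_pred0 // => f /=.
    have := cuv f; apply: contraNF => /orP[] /andP[/eqP-> /eqP->]; by rewrite cik.
  have := matching_correlation Z0 (fun i k => ler0n _ _) wc
    (fun S i => monomer_dimer_vertex lam L uv (i := i)) (finset.in_setT _) (finset.in_setT _) (uv e).
  by rewrite (negbTE (cuv e)).
move=> y z y0 z0.
pose lam1 x : R := lam x + (if x == u e then y else 0).
pose lam2 x : R := lam1 x + (if x == v e then z else 0).
have -> : monomer_dimer u v lam L [set: V] +
    monomer_dimer u v lam L ([set: V] :\ u e) * y +
    monomer_dimer u v lam L ([set: V] :\ v e) * z +
    monomer_dimer u v lam L ([set: V] :\ u e :\ v e) * (y * z) =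
    monomer_dimer u v lam2 L [set: V].
  have mu1 (S : {set V}) : u e \in S -> monomer_dimer u v lam1 L S = _ :=
    @monomer_dimer_add R V E u v lam L S (u e) y uv.
  rewrite /lam2 monomer_dimer_add ?inE // !mu1 ?inE ?uv // (setD1C _ (v e)).
  by ring.
have lam2_ge0 x : 0 <= lam2 x.
  by rewrite !addr_ge0 //; case: ifP => // _; apply: ltW.
apply: le_trans (IH lam2 lam2_ge0 _); last first.
  move=> x; apply: le_trans (al1 x); rewrite big_cons; case: ifP => // _.
  by rewrite lerDr ltW.
rewrite -/K -mulrA -mulrA ler_wpM2l //.
(* At an end of [e] the slack [be] is [be' + t], so weighted AM-GM splits off [y / t] or [z / t] to
   the power [t]. The other vertices contribute 1. *)
pose G x := (if x == u e then (y / t) `^ t else 1) *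
            (if x == v e then (z / t) `^ t else 1).
have prodG : \prod_x G x = y `^ t * z `^ t / (t `^ t * t `^ t).
  rewrite big_split /= -!big_mkcond /= !big_pred1_eq.
  have divt s : 0 < s -> (s / t) `^ t = s `^ t / t `^ t.
    move=> s0; apply: (canRL (mulfK _)); first by rewrite gt_eqF.
    by rewrite -powRM ?divr_ge0 ?(ltW s0) ?(ltW t0) // divfK // gt_eqF.
  by rewrite !divt //; field; rewrite gt_eqF.
have -> : (t `^ t * t `^ t)^-1 * (y `^ t * z `^ t) = \prod_x G x.
  by rewrite prodG mulrC.
rewrite /F -big_split /=; apply: ler_prod => x _.
have G0 : 0 <= G x by rewrite /G mulr_ge0 //; case: ifP => // _; rewrite powR_ge0.
rewrite mulr_ge0 ?powR_ge0 //= -/(be x) /G /lam2 /lam1 /be'.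
have [->|xu] := eqVneq x (u e).
  rewrite (negbTE (uv e)) /= mulr1 addr0.
  have := @powR_amgm R (be' (u e)) t (lam (u e)) y (be'0 _) t0 (lam0 _) y0.
  by rewrite /be' eqxx subrK.
have [->|xv] := eqVneq x (v e).
  rewrite /= mul1r addr0.
  have := @powR_amgm R (be' (v e)) t (lam (v e)) z (be'0 _) t0 (lam0 _) z0.
  by rewrite /be' eqxx orbT subrK.
by rewrite /= !mulr1 !addr0 subr0.
Qed.

(** * Matchings of prescribed size *)

Definition cover_degree (V E : finType) (u v : E -> V) (M : {set E}) (x : V) : nat :=
  (\sum_(e in M) ((u e == x) || (v e == x)))%N.

(** Prescribing degree 0 outside [S] also excludes edges that leave [S]. *)
Definition perfect_matchings (V E : finType) (u v : E -> V) (L : seq E)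
    (S : {set V}) : {set {set E}} :=
  [set M : {set E} | [forall e in M, e \in L] &&
                     [forall x, cover_degree u v M x == (x \in S)]].

(** With zero weights any uncovered vertex kills its term. Since [L] has no repetition, the edge
    sets with and without the head edge form disjoint classes. *)
Lemma monomer_dimer0_le (R : realDomainType) (V E : finType) (u v : E -> V)
    (L : seq E) (S : {set V}) :
  (forall e, u e != v e) -> uniq L ->
  monomer_dimer u v (fun=> 0 : R) L S <= #|perfect_matchings u v L S|%:R.
Proof.
move=> uv; elim: L S => [|e L IH] S /=.
  move=> _; have [->|[x xS]] := set_0Vmem S; last first.
    by rewrite (bigD1 x) //= mul0r ler0n.
  rewrite big_set0 ler1n card_gt0; apply/set0Pn; exists finset.set0.
  rewrite inE; apply/andP; split; apply/forallP => x; rewrite inE //.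
  by rewrite /cover_degree big_set0.
move=> /andP[eL uL].
have sub1 : perfect_matchings u v L S \subset perfect_matchings u v (e :: L) S.
  apply/fintype.subsetP => M; rewrite !inE => /andP[/forall_inP ML ->]; rewrite andbT.
  by apply/forall_inP => f /ML fL; rewrite inE fL orbT.
case: ifPn => [/andP[uS vS]|_]; last first.
  by rewrite addr0; apply: le_trans (IH S uL) _; rewrite ler_nat subset_leq_card.
pose P2 := [set e |: M | M in perfect_matchings u v L (S :\ u e :\ v e)]%SET.
have notin M : M \in perfect_matchings u v L (S :\ u e :\ v e) -> e \notin M.
  by rewrite inE => /andP[/forall_inP ML _]; apply: contra eL => /ML.
have sub2 : P2 \subset perfect_matchings u v (e :: L) S.
  apply/fintype.subsetP => _ /imsetP[M MP ->]; have eM := notin M MP.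
  move: MP; rewrite !inE => /andP[/forall_inP ML /forallP MS]; apply/andP; split.
    by apply/forall_inP => f; rewrite !inE => /orP[->|/ML ->] //; rewrite orbT.
  apply/forallP => x; rewrite /cover_degree big_setU1 //=.
  have := MS x; rewrite /cover_degree => /eqP ->; rewrite !inE !(eq_sym _ x).
  have [->|xu] := eqVneq x (u e); first by rewrite andbF uS.
  by have [->|xv] := eqVneq x (v e); rewrite /= ?vS.
have dis : perfect_matchings u v L S :&: P2 = finset.set0.
  apply/setP => N; rewrite !inE.
  apply/negbTE/negP => /andP[/andP[/forall_inP NL _] /imsetP[M MP NE]].
  by move: eL; rewrite NL // NE setU11.
apply: (@le_trans _ _ (#|perfect_matchings u v L S| + #|P2|)%:R).
  rewrite natrD; apply: lerD; first exact: IH.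
  rewrite card_in_imset; first exact: IH.
  by move=> M N MP NP MN; rewrite -(setU1K (notin M MP)) -(setU1K (notin N NP)) MN.
rewrite ler_nat -cardsUI dis cards0 addn0.
by rewrite subset_leq_card // finset.subUset sub1.
Qed.

Definition matchings (V E : finType) (u v : E -> V) (l : nat) : {set {set E}} :=
  [set M : {set E} | [forall x, (cover_degree u v M x <= 1)%N] && (#|M| == l)].

Lemma sum_cover_degree (V E : finType) (c : V -> bool) (u v : E -> V)
    (M : {set E}) (b : bool) :
  (forall e, c (u e)) -> (forall e, ~~ c (v e)) ->
  (\sum_(x | c x == b) cover_degree u v M x = #|M|)%N.
Proof.
move=> cu cv; rewrite exchange_big /= -sum1_card; apply: eq_bigr => e _.
rewrite (bigD1 (if b then u e else v e)) /=; last first.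
  by case: b; rewrite ?cu // (negbTE (cv e)).
rewrite big1; first by case: b; rewrite eqxx ?orbT.
move=> x /andP[/eqP cx]; case: b cx => cx xn; apply/eqP; rewrite eqb0 negb_or.
  by rewrite eq_sym xn /=; apply: contraTneq cx => <-; apply: cv.
rewrite [v e == x]eq_sym xn andbT; apply: contraFneq cx => <-; apply: cu.
Qed.

Lemma card_uncovered (V E : finType) (c : V -> bool) (u v : E -> V) (n l : nat)
    (M : {set E}) (b : bool) :
  (forall e, c (u e)) -> (forall e, ~~ c (v e)) -> #|[set x | c x == b]| = n ->
  M \in matchings u v l ->
  #|[set x | (c x == b) && (cover_degree u v M x == 0)]%N| = (n - l)%N.
Proof.
move=> cu cv cn; rewrite inE => /andP[/forallP M1 /eqP <-].
rewrite -(sum_cover_degree M b cu cv) -cn -sum1dep_card.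
rewrite -[X in _ = (X - _)%N]sum1dep_card -sumnB => [|x _]; last exact: M1.
rewrite big_mkcondr /=; apply: eq_bigr => x _.
by have := M1 x; case: (cover_degree u v M x) => [|[]].
Qed.

(* [m] new vertices are added on each side; the edge [inr (k, x)] joins [x] to
   the [k]-th new vertex of the side opposite to [x]. *)
Definition ext_u (V E : finType) (u : E -> V) (m : nat)
    (e : E + 'I_m * V) : V + bool * 'I_m :=
  match e with inl e => inl (u e) | inr (_, x) => inl x end.

Definition ext_v (V E : finType) (c : V -> bool) (v : E -> V) (m : nat)
    (e : E + 'I_m * V) : V + bool * 'I_m :=
  match e with inl e => inl (v e) | inr (k, x) => inr (c x, k) end.

Arguments ext_u {V E} u m e.
Arguments ext_v {V E} c v m e.

Lemma cover_degree_ext_inl (V E : finType) (c : V -> bool) (u v : E -> V) (m : nat)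
    (M : {set E + 'I_m * V}) (x : V) :
  cover_degree (ext_u u m) (ext_v c v m) M (inl x) =
  (cover_degree u v [set e | inl e \in M] x + \sum_(k < m) (inr (k, x) \in M))%N.
Proof.
rewrite /cover_degree big_mkcond big_sumType /=; congr (_ + _)%N.
  by rewrite [RHS]big_mkcond; apply: eq_bigr => e _; rewrite inE.
rewrite (eq_bigr (fun p => if (p.2 == x) then nat_of_bool (inr (p.1, x) \in M) else 0%N)).
  rewrite -(pair_big xpredT xpredT (fun k y => if y == x then nat_of_bool (inr (k, x) \in M) else 0%N)) /=.
  by apply: eq_bigr => k _; rewrite -big_mkcond /= big_pred1_eq.
by move=> [k y] _ /=; rewrite orbF; case: (eqVneq y x) => [->|yx];
  [rewrite eqxx; case: ifP | rewrite (_ : inl y == inl x = false) ?if_same //; apply: negbTE].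
Qed.

Lemma cover_degree_ext_inr (V E : finType) (c : V -> bool) (u v : E -> V) (m : nat)
    (M : {set E + 'I_m * V}) (b : bool) (k : 'I_m) :
  cover_degree (ext_u u m) (ext_v c v m) M (inr (b, k)) =
  #|[set x | (c x == b) && (inr (k, x) \in M)]|.
Proof.
rewrite /cover_degree big_mkcond big_sumType /= big1 ?add0n; last first.
  by move=> e _; case: ifP.
rewrite -sum1dep_card [RHS]big_mkcond /=.
transitivity (\sum_(k' < m) \sum_(y : V) if inr (k', y) \in M
    then nat_of_bool (inr (c y, k') == inr (b, k) :> V + bool * 'I_m) else 0)%N.
  by rewrite pair_bigA; apply: eq_bigr => -[].
rewrite exchange_big /=; apply: eq_bigr => y _.
rewrite (bigD1 k) //= big1 ?addn0 => [|k' /negbTE kk].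
  rewrite (_ : inr _ == inr _ = (c y == b)); first by case: ifP; case: eqP.
  by rewrite -[LHS]/((_, _) == (_, _)) xpair_eqE eqxx andbT.
case: ifP => // _; rewrite (_ : inr _ == inr _ = false) //.
by rewrite -[LHS]/((_, _) == (_, _)) xpair_eqE kk andbF.
Qed.

(** A perfect matching of the extended graph is determined by its old edges, a matching of size [l],
    and by two injections sending the new vertices to their partners among the [n - l] uncovered
    vertices of each colour. *)
Lemma card_perfect_matchings_ext (V E : finType) (c : V -> bool) (u v : E -> V)
    (n l : nat) :
  (forall e, c (u e)) -> (forall e, ~~ c (v e)) ->
  (forall b, #|[set x | c x == b]| = n) -> (0 < n)%N -> (l <= n)%N ->
  (#|perfect_matchings (ext_u u (n - l)) (ext_v c v (n - l))
        (enum {: E + 'I_(n - l) * V}) [set: V + bool * 'I_(n - l)]|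
    <= #|matchings u v l| * ((n - l)`! * (n - l)`!))%N.
Proof.
move=> cu cv cn n0 ln; set m := (n - l)%N.
have [x0 _] : exists x0, x0 \in [set x | c x == true].
  by apply/set0Pn; rewrite -card_gt0 cn.
pose U M b := [set x | (c x == b) && (cover_degree u v M x == 0)%N].
pose H M b := [set h : {ffun 'I_m -> V} in ffun_on (mem (U M b)) | injectiveb h].
have cardH M b : M \in matchings u v l -> #|H M b| = m`!.
  by move=> Ml; rewrite card_inj_ffuns_on card_ord (card_uncovered cu cv (cn b) Ml) ffactnn.
pose T : {set {set E} * ({ffun 'I_m -> V} * {ffun 'I_m -> V})} :=
  [set t | (t.1 \in matchings u v l) && ((t.2.1 \in H t.1 true) && (t.2.2 \in H t.1 false))].
have cardT : #|T| = (#|matchings u v l| * (m`! * m`!))%N.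
  rewrite -sum1dep_card -(pair_big_dep (mem (matchings u v l))
    (fun M hh => (hh.1 \in H M true) && (hh.2 \in H M false)) (fun _ _ => 1%N)) /=.
  rewrite -sum_nat_const; apply: eq_bigr => M MM.
  rewrite -{1}(cardH M true MM) -(cardH M false MM) -cardsX -sum1_card.
  by apply: eq_bigl => -[h1 h0]; rewrite finset.in_setX.
(* The partner of the new vertex [(b, k)]; [x0] is only a default, never taken when [M] is
   perfect. *)
pose h (M : {set E + 'I_m * V}) b :=
  [ffun k => odflt x0 [pick x | (c x == b) && (inr (k, x) \in M)]].
pose f (M : {set E + 'I_m * V}) := ([set e | inl e \in M], (h M true, h M false)).
set PM := perfect_matchings _ _ _ _.
have covl (M : {set E + 'I_m * V}) x : M \in PM ->
    (cover_degree u v [set e | inl e \in M] x + \sum_(k < m) (inr (k, x) \in M) = 1)%N.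
  rewrite inE => /andP[_ /forallP /(_ (inl x)) /eqP].
  by rewrite cover_degree_ext_inl !inE.
have hE (M : {set E + 'I_m * V}) k x : M \in PM -> (inr (k, x) \in M) = (h M (c x) k == x).
  rewrite inE => /andP[_ /forallP /(_ (inr (c x, k))) /eqP].
  rewrite cover_degree_ext_inr inE => /eqP/cards1P[y yE].
  have P z : (c z == c x) && (inr (k, z) \in M) = (z == y).
    by move/setP/(_ z): yE; rewrite !inE.
  rewrite ffunE; case: pickP => [z|] /=; last by move/(_ y); rewrite P eqxx.
  by rewrite P => /eqP ->; have := P x; rewrite eqxx /= eq_sym.
have hc (M : {set E + 'I_m * V}) b k : M \in PM -> c (h M b k) = b /\ inr (k, h M b k) \in M.
  rewrite inE => /andP[_ /forallP /(_ (inr (b, k))) /eqP].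
  rewrite cover_degree_ext_inr inE => /eqP/cards1P[y yE].
  rewrite ffunE; case: pickP => [z /andP[/eqP]|] //= /(_ y).
  by move/setP/(_ y): yE; rewrite !inE eqxx => ->.
rewrite -cardT -(card_in_imset (f := f) (D := PM)) => [|M N MP NP [E1 h1 h0]].
  apply/subset_leq_card/fintype.subsetP => _ /imsetP[M MP ->].
  have hH b : h M b \in H [set e | inl e \in M] b.
    rewrite inE; apply/andP; split.
      apply/ffun_onP => k; have [cb kM] := hc M b k MP.
      rewrite inE cb eqxx /=; have := covl M (h M b k) MP.
      by rewrite (bigD1 k) //= kM addnCA add1n => -[/eqP]; rewrite addn_eq0 => /andP[].
    apply/injectiveP => k k' kk; have [_ kM] := hc M b k MP.
    have [_ kM'] := hc M b k' MP; apply/eqP; apply: contraT => nk.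
    have := covl M (h M b k) MP.
    rewrite (bigD1 k) //= kM (bigD1 k') 1?eq_sym //= kk kM'.
    by rewrite addnCA add1n addnCA add1n.
  rewrite inE /= !hH !andbT inE; apply/andP; split.
    by apply/forallP => x; rewrite -(covl M x MP) leq_addr.
  (* Each of the [n] vertices of colour [true] is covered once, [m] of them by new edges, hence [l]
     by old edges. *)
  have := sum_cover_degree [set e | inl e \in M] true cu cv => <-.
  apply/eqP/(@addIn m); rewrite [RHS]subnKC // -[RHS](cn true) -[RHS]sum1dep_card.
  rewrite -[RHS](eq_bigr _ (fun x _ => covl M x MP)) big_split /=; congr (_ + _)%N.
  rewrite exchange_big /= -[LHS]card_ord -[LHS]sum1_card.
  apply: eq_bigr => k _; have [cb kM] := hc M true k MP.
  rewrite [RHS](bigD1 (h M true k)) ?cb //= kM big1 // => x /andP[/eqP cx xh].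
  by rewrite hE // cx eq_sym (negbTE xh).
apply/setP => -[e|[k x]]; first by move/setP/(_ e): E1; rewrite !inE.
by rewrite !hE //; case: (c x); rewrite ?h1 ?h0.
Qed.

Lemma card_edges (V E : finType) (c : V -> bool) (u v : E -> V) (r : nat) (b : bool) :
  (forall e, c (u e)) -> (forall e, ~~ c (v e)) ->
  (forall x, cover_degree u v [set: E] x = r) ->
  (#|[set x | c x == b]| * r = #|E|)%N.
Proof.
move=> cu cv reg; rewrite -cardsT -(sum_cover_degree [set: E] b cu cv).
by rewrite -sum_nat_const big_mkcond [RHS]big_mkcond; apply: eq_bigr => x _; rewrite inE reg.
Qed.

(** The Bethe bound for the extended graph with weight [a] on the [n * r] old edges and [1 / n] on
    the [(n - l) * (n + n)] new ones. The weights add up to [r * a + (n - l) / n = 1] at an old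
    vertex and to [n / n = 1] at a new one. *)
Lemma matchings_bethe (R : realType) (V E : finType) (c : V -> bool) (u v : E -> V)
    (n r l : nat) (a : R) :
  (forall e, c (u e)) -> (forall e, ~~ c (v e)) ->
  (forall x, cover_degree u v [set: E] x = r) ->
  (forall b, #|[set x | c x == b]| = n) -> (1 < r)%N -> (1 < n)%N ->
  (0 < l <= n)%N ->
  a = l%:R / n%:R / r%:R ->
  ((1 - a) `^ (1 - a) / a `^ a) ^+ (n * r) *
  ((1 - n%:R^-1) `^ (1 - n%:R^-1) / n%:R^-1 `^ n%:R^-1) ^+ ((n - l) * (n + n))
  <= (#|matchings u v l| * ((n - l)`! * (n - l)`!))%:R.
Proof.
move=> cu cv reg cn r1 n1 /andP[l0 ln] aE; set m := (n - l)%N.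
have n0 : 0 < n%:R :> R by rewrite ltr0n ltnW.
have r0 : 0 < r%:R :> R by rewrite ltr0n ltnW.
have l0R : 0 < l%:R :> R by rewrite ltr0n.
have lnR : l%:R <= n%:R :> R by rewrite ler_nat.
have a01 : 0 < a < 1.
  rewrite aE !divr_gt0 //= ltr_pdivrMr // mul1r ltr_pdivrMr //.
  apply: le_lt_trans lnR _; rewrite ltr_pMl // (ltr_nat _ 1) //.
have ni01 : 0 < (n%:R^-1 : R) < 1 by rewrite invr_gt0 n0 invf_lt1 // (ltr_nat _ 1).
have mE : m%:R = n%:R - l%:R :> R by rewrite natrB.
pose al (e : E + 'I_m * V) : R := match e with inl _ => a | inr _ => n%:R^-1 end.
pose u' := ext_u u m; pose v' := ext_v c v m.
(* The label [b] of a new vertex is the colour of its neighbours, so its own colour is [~~ b]. *)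
pose c' (x : V + bool * 'I_m) := match x with inl x => c x | inr (b, _) => ~~ b end.
have cuv e : c' (u' e) != c' (v' e).
  by case: e => [e|[k x]] /=; [rewrite cu; move: (cv e); case: (c _) | case: (c x)].
have al1 x : \sum_(e <- enum {: E + 'I_m * V} | (u' e == x) || (v' e == x)) al e = 1.
  rewrite big_enum_cond big_mkcond big_sumType /=.
  rewrite (eq_bigr (fun e : E => a * ((u' (inl e) == x) || (v' (inl e) == x))%:R)); last first.
    by move=> e _ /=; case: ifP; rewrite ?mulr1 ?mulr0.
  rewrite [X in _ + X](eq_bigr (fun p => n%:R^-1 *
     ((u' (inr p) == x) || (v' (inr p) == x))%:R)); last first.
    by move=> p _ /=; case: ifP; rewrite ?mulr1 ?mulr0.
  rewrite -!mulr_sumr -!natr_sum.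
  set A := (\sum_(e : E) _)%N; set B := (\sum_(p : 'I_m * V) _)%N.
  pose M0 := [set e : E + 'I_m * V | if e is inr _ then true else false]%SET.
  have BE : B = cover_degree u' v' M0 x.
    rewrite /cover_degree big_mkcond big_sumType /= big1 ?add0n; last first.
      by move=> e _; rewrite inE.
    by apply: eq_bigr => p _; rewrite inE.
  case: x => [x|[b k]] in A B BE *.
    have -> : A = r.
      by rewrite -(reg x) /cover_degree big_mkcond; apply: eq_bigr => e _; rewrite inE.
    have -> : B = m.
      rewrite BE cover_degree_ext_inl /cover_degree big1 ?add0n.
        by rewrite -[RHS]card_ord -sum1_card; apply: eq_bigr => k _; rewrite inE.
      by move=> e; rewrite !inE.
    by rewrite mE aE; field; rewrite !gt_eqF.
  have -> : A = 0%N by rewrite /A big1.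
  have -> : B = n.
    rewrite BE cover_degree_ext_inr -(cn b); apply: eq_card => y.
    by rewrite !inE andbT.
  by rewrite mulr0 add0r mulVf // gt_eqF.
have cardV : #|V| = (n + n)%N.
  rewrite -(cardC [set x | c x == true]) cn -(cn false); congr (_ + _)%N.
  by apply: eq_card => x; rewrite !inE; case: (c x).
have al01 e : 0 < al e < 1 by case: e.
have uv' e : u' e != v' e by apply: contraNneq (cuv e) => ->.
have alle x : \sum_(e <- enum {: E + 'I_m * V} | (u' e == x) || (v' e == x)) al e <= 1.
  by rewrite al1.
have := monomer_dimer_bethe cuv al01 (fun=> lexx 0) alle.
(* All slacks are 0, so every vertex factor is a zeroth power, equal to 1 although the vertex
   weights are 0. *)
rewrite [X in _ * X]big1 ?mulr1; last by move=> x _; rewrite al1 subrr powRr0.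
rewrite big_enum_cond big_sumType /= !prodr_const.
rewrite card_prod card_ord cardV -(card_edges true cu cv reg) cn => Z.
apply: le_trans Z _; apply: le_trans (monomer_dimer0_le R [set: _] uv' (enum_uniq _)) _.
by rewrite ler_nat; apply: card_perfect_matchings_ext => //; exact: ltnW.
Qed.

(** * Logarithmic form of the bound *)

(** A one-sided Stirling bound whose error is negligible after division by [n]. The induction step
    is [(m + 2) * ln ((m + 2) / (m + 1)) >= 1]. *)
Lemma ln_factorial_le (R : realType) (m : nat) :
  ln (m`!%:R : R) <= m.+1%:R * ln m.+1%:R - m%:R.
Proof.
elim: m => [|m IH]; first by rewrite fact0 ln1 mulr0 subrr.
rewrite factS natrM lnM ?posrE ?ltr0n ?fact_gt0 //.
have m1 : 0 < m.+1%:R :> R by rewrite ltr0n.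
have m2 : 0 < m.+2%:R :> R by rewrite ltr0n.
have := ln_le_subr1 (divr_gt0 m1 m2); rewrite ln_div ?posrE // => H.
have e1 : m.+1%:R = m%:R + 1 :> R by rewrite natr1.
have e2 : m.+2%:R = m%:R + 2 :> R by rewrite -natr1 e1; ring.
have : m.+2%:R * (ln m.+1%:R - ln m.+2%:R) <= -1 :> R.
  apply: le_trans (ler_wpM2l (ltW m2) H) _.
  by rewrite mulrBr mulr1 mulrCA divff ?gt_eqF // mulr1; lra.
move: IH; move: (ln m.+1%:R) (ln m.+2%:R) (ln m`!%:R) => x y z.
by rewrite e2 e1; lra.
Qed.

(** Logarithm of [matchings_bethe]: the loss [2 * m] from the new edges in [HY] cancels the gain
    [2 * m] from the two factorials. *)
Lemma ln_matchings_ge (R : realType) (V E : finType) (c : V -> bool) (u v : E -> V)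
    (n r l : nat) (q : R) :
  (forall e, c (u e)) -> (forall e, ~~ c (v e)) ->
  (forall x, cover_degree u v [set: E] x = r) ->
  (forall b, #|[set x | c x == b]| = n) -> (1 < r)%N -> (1 < n)%N ->
  (0 < l <= n)%N -> q = l%:R / n%:R ->
  n%:R * ((r%:R - q) * ln (1 - q / r%:R) - q * ln (q / r%:R)) +
  2 * ((n - l)%:R * ln n%:R - (n - l).+1%:R * ln (n - l).+1%:R)
  <= ln (#|matchings u v l|%:R : R).
Proof.
move=> cu cv reg cn r1 n1 lln qE; set m := (n - l)%N.
have n0 : 0 < n%:R :> R by rewrite ltr0n ltnW.
have n1R : 1 < n%:R :> R by rewrite (ltr_nat _ 1).
have r0 : 0 < r%:R :> R by rewrite ltr0n ltnW.
have r1R : 1 < r%:R :> R by rewrite (ltr_nat _ 1).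
have q0 : 0 < q by case/andP: lln => l0 _; rewrite qE divr_gt0 // ltr0n.
have q1 : q <= 1 by case/andP: lln => _ l_le_n; rewrite qE ler_pdivrMr // mul1r ler_nat.
have := matchings_bethe (R := R) cu cv reg cn r1 n1 lln erefl; rewrite -qE -/m.
set a := q / r%:R.
have a0 : 0 < a by rewrite divr_gt0.
have a1 : 0 < 1 - a by rewrite subr_gt0 ltr_pdivrMr //; lra.
have ni0 : 0 < n%:R^-1 :> R by rewrite invr_gt0.
have ni1 : 0 < 1 - n%:R^-1 :> R by rewrite subr_gt0 invf_lt1.
set X := _ / a `^ a; set Y := _ / n%:R^-1 `^ n%:R^-1 => H.
have X0 : 0 < X by rewrite /X divr_gt0 // powR_gt0.
have Y0 : 0 < Y by rewrite /Y divr_gt0 // powR_gt0.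
have XY0 : 0 < X ^+ (n * r) * Y ^+ (m * (n + n)).
  exact: mulr_gt0 (exprn_gt0 _ X0) (exprn_gt0 _ Y0).
have N0 := lt_le_trans XY0 H.
have NN : (0 < #|matchings u v l|)%N.
  by move: N0; rewrite ltr0n muln_gt0 => /andP[].
have NR : 0 < #|matchings u v l|%:R :> R by rewrite ltr0n.
have f0 : 0 < m`!%:R :> R by rewrite ltr0n fact_gt0.
move: H; rewrite -ler_ln ?posrE // !natrM (lnM NR (mulr_gt0 f0 f0)) (lnM f0 f0).
rewrite (lnM (exprn_gt0 _ X0) (exprn_gt0 _ Y0)) !lnXn //.
rewrite [ln X]ln_div ?posrE ?powR_gt0 // [ln Y]ln_div ?posrE ?powR_gt0 //.
rewrite !ln_powR lnV ?posrE // -[_ *+ (n * r)]mulr_natr -[_ *+ (m * _)]mulr_natr.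
rewrite !natrM natrD => H.
have aE : r%:R * a = q by rewrite /a mulrCA divff ?gt_eqF // mulr1.
have HX : ((1 - a) * ln (1 - a) - a * ln a) * (n%:R * r%:R) =
    n%:R * ((r%:R - q) * ln (1 - a) - q * ln a) by rewrite -aE; ring.
have HY : m%:R * (2 * ln n%:R) - 2 * m%:R <= ((1 - n%:R^-1) * ln (1 - n%:R^-1)
    - n%:R^-1 * - ln n%:R) * (m%:R * (n%:R + n%:R)) :> R.
  have e1 : ((1 - n%:R^-1) * ln (1 - n%:R^-1) - n%:R^-1 * - ln n%:R) *
    (m%:R * (n%:R + n%:R)) =
    m%:R * 2 * ((n%:R - 1) * ln (1 - n%:R^-1) + ln n%:R) :> R.
    by field; rewrite gt_eqF.
  (* This is [ln x <= x - 1] at [x = n / (n - 1)]. *)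
  have e2 : - 1 <= (n%:R - 1) * ln (1 - n%:R^-1) :> R.
    have := ln_le_subr1 (_ : 0 < (1 - n%:R^-1)^-1 :> R).
    rewrite invr_gt0 lnV ?posrE // => /(_ ni1) h.
    have p1 : 0 <= n%:R - 1 :> R by lra.
    have := ler_wpM2l p1 h.
    have -> : (n%:R - 1) * ((1 - n%:R^-1)^-1 - 1) = 1 :> R.
      by field; rewrite subr_eq0 !gt_eqF.
    lra.
  rewrite e1; have m0 : 0 <= m%:R * 2 :> R by rewrite mulr_ge0.
  have := ler_wpM2l m0 e2; lra.
have := ln_factorial_le R m.
move: H; rewrite HX; lra.
Qed.

(** * From bipartite multigraphs to edges with coloured ends *)

Lemma regular_bipartite_matchings (r n : nat) (G : multigraph) :
  (0 < r)%N -> regular_bipartite n.*2 r G ->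
  exists (c : vertex G -> bool) (u v : edge G -> vertex G),
  [/\ forall e, c (u e), forall e, ~~ c (v e),
      forall x, cover_degree u v [set: edge G] x = r,
      forall b, #|[set x | c x == b]| = n &
      forall l, phi l G = #|matchings u v l|].
Proof.
move=> r0 [cV reg [A HA]].
have [uv uvE] : exists uv : edge G -> vertex G * vertex G, forall e,
    [/\ ends e = [set (uv e).1; (uv e).2], (uv e).1 \in A & (uv e).2 \notin A].
  apply: (fin_all_exists (P := fun e (p : vertex G * vertex G) =>
    [/\ ends e = [set p.1; p.2], p.1 \in A & p.2 \notin A])) => e.
  have /eqP/cards1P[x xE] := HA e.
  have : #|ends e :\: A| == 1%N by rewrite cardsD card_ends HA.
  move=> /cards1P[y yE]; exists (x, y) => /=.
  have xx : x \in ends e :&: A by rewrite xE inE.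
  have yy : y \in ends e :\: A by rewrite yE inE.
  move: xx yy; rewrite !inE => /andP[_ xA] /andP[yA _]; split => //.
  by rewrite -[LHS](finset.setID _ A) xE yE.
pose u e := (uv e).1; pose v e := (uv e).2.
have inc e x : (x \in ends e) = (u e == x) || (v e == x).
  by have [-> _ _] := uvE e; rewrite !inE !(eq_sym x).
have cu e : u e \in A by have [] := uvE e.
have cv e : v e \notin A by have [] := uvE e.
have regc x : cover_degree u v [set: edge G] x = r.
  rewrite -(reg x) /degree -sum1dep_card /cover_degree big_mkcond [RHS]big_mkcond.
  by apply: eq_bigr => e _; rewrite !inE inc.
exists (mem A), u, v; split => //.
  have h b := card_edges b cu cv regc.
  (* Each side meets every edge exactly once, so [r > 0] forces the two sides to have equal size. *)
  have eqb : #|[set x | (x \in A) == true]| = #|[set x | (x \in A) == false]|.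
    by apply/eqP; rewrite -(eqn_pmul2r r0) !h.
  have sumb : (#|[set x | (x \in A) == true]| + #|[set x | (x \in A) == false]|)%N = n.*2.
    rewrite -cV -(cardC [set x | (x \in A) == true]); congr (_ + _)%N.
    by apply: eq_card => x; rewrite !inE; case: (x \in A).
  case; first by apply: double_inj; rewrite -sumb -addnn eqb.
  by apply: double_inj; rewrite -sumb -addnn eqb.
move=> l; apply: eq_card => M; rewrite !inE; congr (_ && _).
have covE x : cover_degree u v M x = #|[set e in M | x \in ends e]|.
  rewrite -sum1dep_card /cover_degree big_mkcondr; apply: eq_bigr => e _.
  by rewrite inc.
apply/idP/forallP => [/forall_inP MM x|MM].
  rewrite covE; apply/card_le1_eqP => e f; rewrite !inE => /andP[eM xe] /andP[fM xf].
  apply/eqP; apply: contraT => ef.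
  have /forall_inP/(_ f fM)/implyP := MM e eM; rewrite eq_sym ef => /(_ isT).
  by move=> /disjointFr/(_ xe); rewrite xf.
apply/forall_inP => e eM; apply/forall_inP => f fM; apply/implyP => ef.
apply/pred0P => x; apply/negbTE/negP => /andP[/= xe xf].
have := MM x; rewrite covE => /card_le1_eqP/(_ e f); rewrite !inE eM fM xe xf.
by move=> /(_ isT isT) efE; rewrite efE eqxx in ef.
Qed.

(** * The limit *)

Local Open Scope classical_set_scope.

Lemma limn_einf_ge (R : realType) (f g : nat -> R) (l : R) :
  f k @[k --> \oo] --> l -> (\forall k \near \oo, f k <= g k) ->
  (l%:E <= limn_einf (fun k => (g k)%:E))%E.
Proof.
move=> fl fg; rewrite limn_einf_lim; apply/lee_subgt0Pr => e e0.
apply: lime_ge; first exact: is_cvg_einfs.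
have : \forall k \near \oo, l - e <= g k.
  have lel : l - e < l by lra.
  near=> k; apply: (@le_trans _ _ (f k)); last by near: k.
  by apply: ltW; near: k; apply: (cvgr_gt l fl).
move=> [N _ HN]; exists N => // k /= Nk.
apply: le_ereal_inf_tmp => _ [j /= kj <-].
by rewrite -EFinB lee_fin; apply: HN => /=; apply: leq_trans kj.
Unshelve. all: by end_near. Qed.

(** At 0 the function is squeezed by twice the square root of [|x|]: it is 0 for [x <= 0], and for
    small positive [x] the bound [ln y <= y - 1] is applied to [y = 1 / sqrt x]. *)
Lemma xlnx_cvg (R : realType) (a : R) : 0 <= a ->
  (x * ln x) @[x --> a] --> a * ln a.
Proof.
rewrite le_eqVlt => /orP[/eqP <-|a0]; last first.
  by apply: cvgM; [exact: cvg_id | exact: continuous_ln].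
rewrite mul0r.
have bound : \forall x \near (0 : R), - (2 * Num.sqrt `|x|) <= x * ln x <= 2 * Num.sqrt `|x|.
  have : \forall x \near (0 : R), `|x| < 1.
    by apply: (cvgr_lt _ (@norm_continuous _ R (0 : R))); rewrite normr0 ltr01.
  apply: filterS => x x1.
  have [x0|x0] := leP x 0.
    by rewrite ln0 // mulr0 oppr_le0 mulr_ge0 // sqrtr_ge0.
  rewrite gtr0_norm // in x1 *.
  set s := Num.sqrt x; have s0 : 0 < s by rewrite sqrtr_gt0.
  have sx : x = s ^+ 2 by rewrite sqr_sqrtr // ltW.
  have l1 : ln x <= 0 by rewrite ln_le0 // ltW.
  apply/andP; split; last first.
    apply: (@le_trans _ _ 0); first by rewrite mulr_ge0_le0 // ltW.
    by rewrite mulr_ge0 // ltW.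
  have := ln_le_subr1 (_ : 0 < s^-1); rewrite invr_gt0 => /(_ s0).
  rewrite lnV ?posrE // => h.
  rewrite sx lnXn // -mulr_natr.
  have := ler_wpM2l (ltW (mulr_gt0 s0 s0)) h.
  rewrite (_ : s * s * (s^-1 - 1) = s - s * s); last by field; rewrite gt_eqF.
  have := mulr_gt0 s0 s0; rewrite expr2; nra.
have lim0 : (2 * Num.sqrt `|x|) @[x --> (0 : R)] --> (0 : R).
  rewrite -[X in _ --> X](_ : 2 * Num.sqrt `|0 : R| = 0); last first.
    by rewrite normr0 sqrtr0 mulr0.
  apply: cvgM; first exact: cvg_cst.
  apply: continuous_comp; first exact: norm_continuous.
  exact: sqrt_continuous.
apply: (squeeze_cvgr bound _ lim0).
by rewrite -[X in _ --> X]oppr0; apply: cvgN.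
Unshelve. all: by end_near. Qed.

Lemma gh_le_low (R : realType) (r : nat) (p : R) :
  (2 <= r)%N -> 0 < p <= 1 -> ((gh r p)%:E <= low r p)%E.
Proof.
move=> r2 /andP[p0 p1].
have r0 : 0 < r%:R :> R by rewrite ltr0n ltnW.
have r2R : 2 <= r%:R :> R by rewrite (ler_nat _ 2).
apply: le_ereal_inf_tmp => _ [n [l [ny l_le_n lnp ->]]].
pose q k : R := (l k)%:R / (n k)%:R; pose ni k : R := (n k)%:R^-1.
have nbig : \forall k \near \oo, (1 < n k)%N by move/cvgnyPgt : ny; apply.
have ni0 : ni k @[k --> \oo] --> (0 : R).
  apply/gtr0_cvgV0; last by apply/cvgrnyP.
  by apply: filterS nbig => k nk; rewrite ltr0n ltnW.
have qp : q k @[k --> \oo] --> p by [].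
have u0 : 0 < 1 - p / r%:R by rewrite subr_gt0 ltr_pdivrMr //; lra.
have xlnx_lim (x : nat -> R) (a : R) : 0 <= a -> x k @[k --> \oo] --> a ->
    x k * ln (x k) @[k --> \oo] --> a * ln a.
  by move=> a0 xa; apply: (cvg_comp _ _ xa (xlnx_cvg a0)).
have mlim : 1 - q k + ni k @[k --> \oo] --> 1 - p.
  rewrite -[X in _ --> X]addr0; apply: cvgD => //; apply: cvgB => //; exact: cvg_cst.
(* This is the bound of [ln_matchings_ge] divided by [2 * n], where [(n - l + 1) / n = 1 - q + ni].
   The term [ni * ln ni], which tends to 0, is what remains of the [ln n] terms. *)
apply: (@limn_einf_ge _ (fun k =>
  2^-1 * (((r%:R - q k) * ln (1 - q k / r%:R) + q k * ln r%:R) - q k * ln (q k))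
  - (1 - q k + ni k) * ln (1 - q k + ni k) + ni k * ln (ni k))).
  have -> : gh r p = 2^-1 * (((r%:R - p) * ln (1 - p / r%:R) + p * ln r%:R) - p * ln p)
      - (1 - p) * ln (1 - p) + 0 * ln 0 by rewrite /gh; lra.
  apply: cvgD; last exact: xlnx_lim.
  apply: cvgB; last by apply: xlnx_lim => //; lra.
  apply: cvgM; first exact: cvg_cst.
  apply: cvgB; last by apply: xlnx_lim => //; exact: ltW.
  apply: cvgD; last by apply: cvgM => //; exact: cvg_cst.
  apply: cvgM; first by apply: cvgB => //; exact: cvg_cst.
  apply: (cvg_comp (fun k => 1 - q k / r%:R) (@ln R) _ (continuous_ln u0)).
  apply: cvgB; first exact: cvg_cst.
  by apply: cvgM => //; exact: cvg_cst.
near=> k.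
have nk : (1 < n k)%N by near: k.
have n0 : 0 < (n k)%:R :> R by rewrite ltr0n ltnW.
have q0 : 0 < q k by near: k; apply: (cvgr_gt _ qp).
have lk : (0 < l k <= n k)%N.
  by rewrite l_le_n andbT lt0n; apply: contraTneq q0 => l0; rewrite /q l0 mul0r ltxx.
rewrite /mu; case: ex_minnP => _ /asboolP[G Greg <-] _.
have [c [u [v [cu cv reg cn ->]]]] := regular_bipartite_matchings (ltnW r2) Greg.
have := ln_matchings_ge (R := R) cu cv reg cn r2 nk lk erefl; rewrite -/(q k).
set m := (n k - l k)%N; set N := ln #|_|%:R => H.
have mE : m.+1%:R = (n k)%:R * (1 - q k + ni k) :> R.
  rewrite -natr1 natrB ?l_le_n //.
  by rewrite /q /ni; field; rewrite gt_eqF.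
have m0 : 0 < 1 - q k + ni k.
  by rewrite -(pmulr_rgt0 _ n0) -mE ltr0n.
have mE' : m%:R = (n k)%:R * (1 - q k + ni k) - 1 :> R by rewrite -mE -natr1 addrK.
rewrite ler_pdivlMr ?mulr_gt0 //; apply: le_trans H.
have niE : ni k * (n k)%:R = 1 by rewrite /ni mulVf // gt_eqF.
rewrite mE (lnM n0 m0) mE' (ln_div q0 r0) [ln (ni k)]lnV ?posrE //.
rewrite le_eqVlt; apply/orP; left; apply/eqP.
move: (ln (1 - q k / r%:R)) (ln r%:R) (ln (q k)) (ln (1 - q k + ni k)) (ln (n k)%:R).
move=> A B C D F; rewrite (_ : (_ + ni k * - F) * _ = 
 (2^-1 * ((r%:R - q k) * A + q k * B - q k * C) - (1 - q k + ni k) * D) * (2 * (n k)%:R)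
  - 2 * F * (ni k * (n k)%:R)); last by ring.
by rewrite niE; field.
Unshelve. all: by end_near. Qed.

Theorem theorem3p4 (R : realType) (r : nat) (hr : (2 <= r)%N)
    (p : R) (hp : 0 <= p <= 1) :
  ((low2 r p)%:E <= low r p)%E.
Proof.
have /andP[p0 p1] := hp; have [->|pn0] := eqVneq p 0.
  (* At [p = 0] the [l k] may vanish, so the Bethe bound is replaced by [ln (mu _ _ _) >= 0], valid
     for every natural number as [ln 0 = 0]. *)
  rewrite low2_0; apply: le_ereal_inf_tmp => _ [n [l [_ _ _ ->]]].
  apply: (@limn_einf_ge _ (fun=> 0)); first exact: cvg_cst.
  apply: nearW => k; rewrite divr_ge0 ?mulr_ge0 //.
  by case: (mu _ _ _) => [|m]; [rewrite ln0 | rewrite ln_ge0 // ler1n].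
have p01 : 0 < p <= 1 by rewrite p1 andbT lt_neqAle eq_sym pn0.
apply: le_trans (gh_le_low hr p01); rewrite lee_fin; exact: low2_le_gh.
Qed.
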